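(* Let $T\subset\mathbb{N}=\{1,2,\dots\}$ be finite, let $m\ge0$ be an integer and let $l_i\ge0$ be integers for $i\in T$. Let $N^*(m,\prod_{i\in T}I_i^{l_i},1)$ be the number of monic polynomials of degree $m$ over $\mathbb{F}_q$ which, for each $i\in T$, have exactly $l_i$ monic irreducible factors of degree $i$ counted with multiplicity. Then $$N^*\Big(m,\prod_{i\in T}I_i^{l_i},1\Big)=q^{m}\sum_{(j_i)_{i\in T}}\mathbf{1}\Big[\sum_{i\in T}i(l_i+j_i)\le m\Big]\prod_{i\in T}\binom{|I_i|+l_i-1}{l_i}q^{-il_i}\binom{|I_i|}{j_i}(-1)^{j_i}q^{-ij_i},$$ where the sum runs over all tuples of integers with $0\le j_i\le|I_i|$.
   Context: $\mathbb{F}_q$ is a finite field with $q$ elements; $I_i$ is the set of monic irreducible polynomials of degree $i$ over $\mathbb{F}_q$. The number of monic irreducible factors of $g$ of degree $i$ counted with multiplicity is $\sum_{h\in I_i}\max\{k:h^k\mid g\}$. $\mathbf{1}[P]$ is $1$ if $P$ is true and $0$ otherwise. *)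

(* Defs.v *)
From HB Require Import structures.
From mathcomp Require Import all_boot all_order all_algebra.
From mathcomp Require Import finmap.

Set Implicit Arguments.
Unset Strict Implicit.
Unset Printing Implicit Defensive.

Import GRing.Theory.
Local Open Scope ring_scope.

(* [size p = n.+1] means degree n, so degree-n polynomials live in the finite
   type [{poly_n.+1 F}]. *)
Definition monic_polys (F : finFieldType) (n : nat) : {set {poly_n.+1 F}} :=
  [set g : {poly_n.+1 F} |
    (size (val g) == n.+1) && ((val g : {poly F}) \is monic)].

Definition irr_polys (F : finFieldType) (i : nat) : {set {poly_i.+1 F}} :=
  [set h in monic_polys F i | irreducibleb (val h)].

(* max {k : h^k | g}; the bound k < size g loses nothing when g != 0 and h is
   not constant, see [dvdp_exp_multiplicity]. *)
Definition multiplicity (F : finFieldType) (h g : {poly F}) : nat :=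
  \max_(k < size g | h ^+ k %| g) k.

Definition nb_irr_factors (F : finFieldType) (i : nat) (g : {poly F}) : nat :=
  \sum_(h in irr_polys F i) multiplicity (val h) g.

Definition Nstar (F : finFieldType) (m : nat) (T : {fset nat}) (l : T -> nat)
    : nat :=
  #|[set g in monic_polys F m |
      [forall i : T, nb_irr_factors (val i) (val g) == l i]]|.

Lemma dvdp_exp_multiplicity (F : finFieldType) (h g : {poly F}) (k : nat) :
  (1 < size h)%N -> g != 0 -> (h ^+ k %| g) = (k <= multiplicity h g)%N.
Proof.
move=> h_gt1 g_neq0.
have bound j : h ^+ j %| g -> (j < size g)%N.
  move=> /(dvdp_leq g_neq0); apply: leq_trans.
  have := size_exp h j; have : h ^+ j != 0.
    by rewrite expf_neq0 // -size_poly_eq0; case: (size h) h_gt1.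
  rewrite -size_poly_gt0; case: (size (h ^+ j)) => // s _ /= ->.
  by rewrite ltnS leq_pmull // -ltnS prednK // ltnW.
apply/idP/idP => [hkg | le_k].
  exact: (bigmax_sup (Ordinal (bound _ hkg))).
apply: dvdp_trans (dvdp_exp2l h le_k) _.
rewrite /multiplicity; elim/big_ind: _ => // [|x y hx hy].
  by rewrite expr0 dvd1p.
by case: (leqP x y).
Qed.

(* Main.v *)
(** Divisibility by a fixed monic polynomial of degree [d] is easy to count: it
holds for [q ^ (m - d)] of the monic polynomials of degree [m] if [d <= m], and
for none otherwise. For an irreducible [h], the indicator of "[h] has
multiplicity [e] in [g]" is [1[h^e | g] - 1[h^(e+1) | g]]; by coprimality,
products of such indicators over distinct [h] are again linear combinations of
divisibility indicators. Recording [1[D | g]] as ['X^(deg D)], the condition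
"[l] factors of degree [i]" becomes
['C(|I_i| + l - 1, l) * 'X^(i l) * (1 - 'X^i)^|I_i|], and the count is the value
at the product over [i] of the linear functional
['X^d |-> 1[d <= m] q ^ (m - d)]. *)

Require Import Defs.
From mathcomp Require Import all_boot all_order all_algebra.
From mathcomp Require Import finmap.

Import GRing.Theory.
Local Open Scope ring_scope.

(** * Distributivity and a binomial sum *)

(** Since [J i] varies with [i], the inner sums are moved to tagged elements of one common type,
    where ordinary distributivity applies. *)
Lemma prod_sum_dffun (R : comPzSemiRingType) (I : finType) (J : I -> finType)
    (E : forall i, J i -> R) :
  \prod_i \sum_j E i j = \sum_(f : {dffun forall i : I, J i}) \prod_i E i (f i).
Proof.
rewrite (reindex (@dffun_of_fprod I J)) /=; last first.
  exact/onW_bij/dffun_of_fprod_bij.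
transitivity (\sum_(f : fprod J) \prod_i [ffun j => E i j] (f i)); last first.
  by apply: eq_bigr => f _; apply: eq_bigr => i _; rewrite !ffunE.
rewrite big_fprod; pose G i := [ffun j => E i j].
transitivity (\prod_i \sum_(u in tagged_with J i) untag 0 (G i) u).
  apply: eq_bigr => i _; rewrite -(big_tag (fun i => G i : J i -> R)).
  by apply: eq_bigr => j _; rewrite ffunE.
by rewrite bigA_distr_big_dep.
Qed.

(** Sorts the multisets of size [l] on [n + 1] letters by the multiplicity [e] of one letter. *)
Lemma sum_binom_multiset (n l : nat) :
  (\sum_(e < l.+1) 'C(n + (l - e) - 1, l - e) = 'C(n + l, l))%N.
Proof.
rewrite (reindex_inj rev_ord_inj) /=.
under eq_bigr => e _ do rewrite subSS (subKn (ltn_ord e : e <= l)%N).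
elim: l => [|l IHl]; first by rewrite big_ord1 !bin0.
by rewrite big_ord_recr /= IHl addnS subn1 /= binS addnC.
Qed.

(** * The linear functional on degree polynomials *)

Definition degree_mass (q : rat) (m : nat) (P : {poly rat}) : rat :=
  \sum_(d < m.+1) P`_d * q ^+ (m - d).

Lemma degree_massD q m P Q :
  degree_mass q m (P + Q) = degree_mass q m P + degree_mass q m Q.
Proof.
by rewrite -big_split; apply: eq_bigr => d _; rewrite coefD mulrDl.
Qed.

Lemma degree_massZ q m c P : degree_mass q m (c *: P) = c * degree_mass q m P.
Proof.
by rewrite big_distrr; apply: eq_bigr => d _ /=; rewrite coefZ mulrA.
Qed.

Lemma degree_mass_sum q m (I : finType) (P : I -> {poly rat}) :
  degree_mass q m (\sum_i P i) = \sum_i degree_mass q m (P i).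
Proof.
apply: (big_morph _ (degree_massD q m)).
by apply: big1 => d _; rewrite coef0 mul0r.
Qed.

Lemma degree_massXn q m n :
  degree_mass q m 'X^n = (n <= m)%N%:R * q ^+ (m - n).
Proof.
case: leqP => [le_nm|lt_mn]; last first.
  rewrite mul0r; apply: big1 => d _; rewrite coefXn.
  by rewrite ltn_eqF ?mul0r // (leq_ltn_trans _ lt_mn) // -ltnS.
rewrite /degree_mass (bigD1 (Ordinal (le_nm : n < m.+1)%N)) //= coefXn eqxx.
rewrite big1 ?addr0 // => d; rewrite -val_eqE /= => /negPf nd.
by rewrite coefXn nd mul0r.
Qed.

(** * Counting monic multiples of a fixed polynomial *)

Section FinField.
Set Implicit Arguments.
Unset Strict Implicit.
Variable F : finFieldType.
Implicit Types (g h p D : {poly F}) (s : seq {poly F}) (m i e l : nat).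

(** The monic multiples of degree [m] are [D * ('X^(m - d) + r)] for a unique [r] of degree below
    [m - d], which leaves [q ^ (m - d)] choices. *)
Lemma card_monic_dvd m D : D \is monic ->
  #|[set g in monic_polys F m | D %| val g]|%:R =
    degree_mass #|F|%:R m 'X^((size D).-1).
Proof.
move=> monD; have D0 := monic_neq0 monD; rewrite degree_massXn.
have sD : size D = (size D).-1.+1 by rewrite prednK // size_poly_gt0.
set d := (size D).-1 in sD *; case: leqP => [le_dm|lt_md]; last first.
  rewrite mul0r (_ : [set _ in _ | _] = set0) ?cards0 //.
  apply/setP => g; rewrite !inE; apply/negbTE/negP.
  case/andP => /andP[/eqP sg mong] /(dvdp_leq (monic_neq0 mong)).
  by rewrite sg sD leqNgt ltnS lt_md.
rewrite mul1r -natrX -card_npoly.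
have szX (r : {poly_(m - d) F}) :
    (size (val r) < size ('X^(m - d) : {poly F}))%N.
  by rewrite size_polyXn ltnS size_npoly.
have monX (r : {poly_(m - d) F}) : 'X^(m - d) + val r \is monic.
  by rewrite monicE lead_coefDl ?szX // lead_coefXn.
have szM (r : {poly_(m - d) F}) : size (D * ('X^(m - d) + val r)) = m.+1.
  rewrite size_monicM ?monic_neq0 // size_polyDl ?szX // size_polyXn sD.
  by rewrite addnS addSn /= subnKC.
pose f (r : {poly_(m - d) F}) := npolyp m.+1 (D * ('X^(m - d) + val r)).
have fE r : val (f r) = D * ('X^(m - d) + val r).
  by apply: npolypK; rewrite szM.
have f_inj : injective f.
  move=> r r' /(congr1 val); rewrite !fE => /(mulfI D0) /addrI.
  exact: val_inj.
rewrite -(card_imset _ f_inj); congr (_%:R); apply: eq_card => g.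
rewrite !inE; apply/idP/imsetP => [|[r _ ->]]; last first.
  by rewrite fE szM eqxx monicMl // monX dvdp_mulr.
case/andP => /andP[/eqP sg mong] /dvdpP[k gE].
have monk : k \is monic by move: mong; rewrite gE monicMr.
have sk : size k = (m - d).+1.
  move: sg; rewrite gE size_Mmonic ?monic_neq0 // sD addnS /= => sg.
  by rewrite -subSn // -sg addnK.
(* Subtracting ['X^(m - d)] cancels the leading term of the monic quotient [k]. *)
have szr : (size (k - 'X^(m - d))%R <= m - d)%N.
  apply/leq_sizeP => j; rewrite leq_eqVlt => /orP[/eqP<-|lt_j].
    rewrite coefB coefXn eqxx; move/monicP: monk.
    rewrite /lead_coef sk /= => ->.
    by rewrite subrr.
  by rewrite coefB coefXn gtn_eqF // nth_default ?sk ?subrr.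
exists (npolyp (m - d) (k - 'X^(m - d))) => //; apply: val_inj.
by rewrite fE [val (npolyp _ _)]npolypK // addrC subrK mulrC.
Qed.

(** * Calculus of divisibility indicators *)

(* [dvd_transform s f P]: on nonzero polynomials, [f] is a linear combination
   [\sum_k w_k 1[D_k | g]] of divisibility indicators, each [D_k] having only
   prime factors from [s], and [P = \sum_k w_k 'X^(deg D_k)]. *)
Inductive dvd_transform s : ({poly F} -> rat) -> {poly rat} -> Prop :=
| DvdTransform D of D \is monic
    & (forall p, all (coprimep p) s -> coprimep p D) :
    dvd_transform s (fun g => (D %| g)%R%:R) 'X^((size D).-1)
| DvdTransformD f1 f2 P1 P2 of dvd_transform s f1 P1 & dvd_transform s f2 P2 :
    dvd_transform s (fun g => f1 g + f2 g) (P1 + P2)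
| DvdTransformZ c f P of dvd_transform s f P :
    dvd_transform s (fun g => c * f g) (c *: P)
| DvdTransform_eq f f' P of dvd_transform s f P
    & (forall g, g != 0 -> f g = f' g) :
    dvd_transform s f' P.

(** Both sides are linear, so the count of monic multiples settles it; agreement on nonzero
    polynomials suffices because monic ones are nonzero. *)
Lemma sum_dvd_transform m s f P : dvd_transform s f P ->
  \sum_(g in monic_polys F m) f (val g) = degree_mass #|F|%:R m P.
Proof.
elim=> {f P} [D monD _|f1 f2 P1 P2 _ IH1 _ IH2|c f P _ IH|f f' P _ <- eq_f].
- rewrite -card_monic_dvd // -sum1_card natr_sum.
  rewrite big_mkcond [RHS]big_mkcond; apply: eq_bigr => g _.
  by rewrite [in RHS]inE; case: (g \in _) => //=; case: (D %| _).
- by rewrite big_split /= IH1 IH2 degree_massD.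
- by rewrite -big_distrr /= IH degree_massZ.
- apply: eq_bigr => g; rewrite inE => /andP[_ mong].
  by rewrite eq_f ?monic_neq0.
Qed.

Lemma dvd_transform_const s (c : rat) : dvd_transform s (fun=> c) c%:P.
Proof.
rewrite -alg_polyC -[1](expr0 'X).
have -> : 0%N = (size (1 : {poly F})).-1 by rewrite size_poly1.
have T1 : dvd_transform s (fun g => (1 %| g)%R%:R)
    'X^((size (1 : {poly F})).-1).
  by apply: DvdTransform => [|p _]; rewrite ?monic1 ?coprimep1.
by apply: DvdTransform_eq (DvdTransformZ c T1) _ => g _; rewrite dvd1p mulr1.
Qed.

Lemma dvd_transform_sum s (I : Type) (r : seq I) (f : I -> {poly F} -> rat)
    (P : I -> {poly rat}) : (forall k, dvd_transform s (f k) (P k)) ->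
  dvd_transform s (fun g => \sum_(k <- r) f k g) (\sum_(k <- r) P k).
Proof.
move=> fP; elim: r => [|k r IHr].
  rewrite big_nil -polyC0.
  apply: DvdTransform_eq (dvd_transform_const s 0) _ => g _.
  by rewrite big_nil.
rewrite big_cons; apply: DvdTransform_eq (DvdTransformD (fP k) IHr) _ => g _.
by rewrite big_cons.
Qed.

(** By bilinearity only two indicators need to be multiplied: for coprime [D1] and [D2], both divide
    [g] iff [D1 * D2] does, and degrees add. *)
Lemma dvd_transformM s1 s2 f1 f2 P1 P2 :
    {in s1 & s2, forall h1 h2, coprimep h1 h2} ->
    dvd_transform s1 f1 P1 -> dvd_transform s2 f2 P2 ->
  dvd_transform (s1 ++ s2) (fun g => f1 g * f2 g) (P1 * P2).
Proof.
move=> co12 T1 T2.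
elim: T1 => {f1 P1}
  [D1 mon1 supp1|f f' P P' _ IH _ IH'|c f P _ IH|f f' P _ IH eq_f].
- elim: T2 => {f2 P2}
    [D2 mon2 supp2|f f' P P' _ IH _ IH'|c f P _ IH|f f' P _ IH eq_f].
  (* Each element of [s2] is coprime to all of [s1], hence to [D1]; so [D1] is coprime to all of
     [s2], hence to [D2]. *)
  + have coD : coprimep D1 D2.
      apply: supp2; apply/allP => h2 s2h2; rewrite coprimep_sym.
      by apply: supp1; apply/allP => h1 s1h1; rewrite coprimep_sym co12.
    have -> : 'X^((size D1).-1) * 'X^((size D2).-1) =
              'X^((size (D1 * D2)).-1) :> {poly rat}.
      rewrite size_monicM ?monic_neq0 // -exprD.
      have := monic_neq0 mon1; have := monic_neq0 mon2; rewrite -!size_poly_gt0.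
      by case: (size D1) (size D2) => [|n1] [|n2] //= _ _; rewrite addnS.
    have T12 : dvd_transform (s1 ++ s2) (fun g => (D1 * D2 %| g)%R%:R)
        'X^((size (D1 * D2)).-1).
      apply: DvdTransform => [|p]; first by rewrite monicMl.
      rewrite all_cat coprimepMr => /andP[co1 co2].
      by rewrite supp1 ?supp2.
    by apply: DvdTransform_eq T12 _ => g _; rewrite Gauss_dvdp // -natrM mulnb.
  + rewrite mulrDr; apply: DvdTransform_eq (DvdTransformD IH IH') _ => g _.
    by rewrite mulrDr.
  + rewrite -scalerAr; apply: DvdTransform_eq (DvdTransformZ c IH) _ => g _.
    by rewrite mulrCA.
  + by apply: DvdTransform_eq IH _ => g /eq_f ->.
- rewrite mulrDl; apply: DvdTransform_eq (DvdTransformD IH IH') _ => g _.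
  by rewrite mulrDl.
- rewrite -scalerAl; apply: DvdTransform_eq (DvdTransformZ c IH) _ => g _.
  by rewrite mulrA.
- by apply: DvdTransform_eq IH _ => g /eq_f ->.
Qed.

(** * Prescribed multiplicities *)

Lemma dvd_transform_multiplicity h i e :
    h \is monic -> size h = i.+1 -> (0 < i)%N ->
  dvd_transform [:: h] (fun g => (multiplicity h g == e)%:R)
    ('X^(i * e) * (1 - 'X^i)).
Proof.
move=> monh sh i_gt0.
have Tpow k : dvd_transform [:: h] (fun g => (h ^+ k %| g)%R%:R) 'X^(i * k).
  have -> : (i * k)%N = (size (h ^+ k)).-1 by rewrite size_exp sh.
  apply: DvdTransform => [|p]; first exact: monic_exp.
  by rewrite /= andbT => /coprimep_expr.
rewrite mulrBr mulr1 -exprD addnC -mulnS -scaleN1r.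
have TN := DvdTransformZ (-1) (Tpow e.+1).
apply: DvdTransform_eq (DvdTransformD (Tpow e) TN) _ => g g0.
rewrite !dvdp_exp_multiplicity ?sh // mulN1r.
by case: (ltngtP (multiplicity h g) e); rewrite ?subrr ?subr0.
Qed.

(** Induction on [s]: if the head has multiplicity [e], the tail must contribute [l - e]. *)
Lemma dvd_transform_sum_multiplicity i s l :
    (0 < i)%N -> uniq s ->
    {in s, forall h, h \is monic /\ size h = i.+1} ->
    {in s &, forall h h', h != h' -> coprimep h h'} ->
  dvd_transform s (fun g => (\sum_(h <- s) multiplicity h g == l)%N%:R)
    ('C(size s + l - 1, l)%:R *: ('X^(i * l) * (1 - 'X^i) ^+ size s)).
Proof.
move=> i_gt0; elim: s l => [|h s IHs] l /= => [_ _ _|/andP[s'h Us] mon co].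
  (* With truncated subtraction this binomial is 1 at [l = 0] and 0 otherwise. *)
  have -> : 'C(0 + l - 1, l)%:R *: ('X^(i * l) * (1 - 'X^i) ^+ 0) =
            (0%N == l)%:R%:P :> {poly rat}.
    case: l => [|l]; first by rewrite muln0 !expr0 mulr1 scale1r.
    by rewrite add0n subn1 /= bin_small // scale0r.
  by apply: DvdTransform_eq (dvd_transform_const _ _) _ => g _; rewrite big_nil.
have [monh sh] := mon h (mem_head h s).
have s_sub : {subset s <= h :: s} by move=> x sx; rewrite in_cons sx orbT.
have {}IHs k := IHs k Us (sub_in1 s_sub mon) (sub_in2 s_sub co).
have coh : {in [:: h] & s, forall h1 h2, coprimep h1 h2}.
  move=> h1 h2; rewrite inE => /eqP-> sh2.
  rewrite co ?mem_head ?in_cons ?sh2 ?orbT //.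
  by apply: contraNneq s'h => ->.
have T (e : 'I_l.+1) := dvd_transformM coh
  (dvd_transform_multiplicity e monh sh i_gt0) (IHs (l - e)%N).
have := dvd_transform_sum (index_enum _) T.
set P := \sum_(k <- _) _; set Q := _ *: _; have -> : P = Q.
  rewrite {}/P {}/Q addSn subn1 /= -sum_binom_multiset natr_sum scaler_suml.
  apply: eq_bigr => e _; rewrite -scalerAr mulrACA -exprS -exprD -mulnDr.
  by rewrite subnKC // -ltnS.
move=> TQ; apply: DvdTransform_eq TQ _ => g _; rewrite big_cons.
set a := multiplicity h g; set b := (\sum_(h <- s) _)%N.
(* Only the summand [e = a] can be nonzero; for [a > l] there is none, and the total multiplicity
   already exceeds [l]. *)
case: (leqP a l) => [le_al|lt_la]; last first.
  rewrite big1 => [|e _]; last first.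
    by rewrite gtn_eqF ?mul0r // (leq_ltn_trans _ lt_la) // -ltnS.
  by rewrite gtn_eqF // ltn_addr.
rewrite (bigD1 (Ordinal (le_al : a < l.+1)%N)) //= eqxx mul1r big1 => [|e].
  by rewrite addr0 -(eqn_add2l a b) subnKC.
by rewrite -val_eqE /= eq_sym => /negPf->; rewrite mul0r.
Qed.

(** * Irreducible polynomials of a given degree *)

(** A nonconstant gcd would be associated to both, and monic associates are equal. *)
Lemma irredp_monic_coprimep p h : p \is monic -> h \is monic ->
  irreducible_poly p -> irreducible_poly h -> p != h -> coprimep p h.
Proof.
move=> monp monh irrp irrh; apply: contraR => ncop.
have gp : gcdp p h %= p by apply: irrp; rewrite ?dvdp_gcdl.
have gh : gcdp p h %= h by apply: irrh; rewrite ?dvdp_gcdr.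
by rewrite -eqp_monic // (eqp_trans _ gh) // eqp_sym.
Qed.

(** Dropping the size bound from the type lets different degrees be concatenated. *)
Definition irr_seq i : seq {poly F} :=
  [seq val k | k <- enum (irr_polys F i)].

Lemma irr_seqP i h : h \in irr_seq i ->
  [/\ h \is monic, size h = i.+1 & irreducible_poly h].
Proof.
case/mapP => k; rewrite mem_enum !inE => /andP[/andP[/eqP sk monk] irrk] ->.
by split=> //; apply/irreducibleP.
Qed.

Lemma dvd_transform_nb_irr_factors i l : (0 < i)%N ->
  dvd_transform (irr_seq i) (fun g => (nb_irr_factors i g == l)%:R)
    ('C(#|irr_polys F i| + l - 1, l)%:R *:
       ('X^(i * l) * (1 - 'X^i) ^+ #|irr_polys F i|)).
Proof.
move=> i_gt0; have sz : size (irr_seq i) = #|irr_polys F i|.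
  by rewrite size_map -cardE.
rewrite -sz.
apply: DvdTransform_eq (dvd_transform_sum_multiplicity l i_gt0 _ _ _) _.
- by rewrite map_inj_uniq ?enum_uniq //; apply: val_inj.
- by move=> h /irr_seqP[].
- move=> h h' /irr_seqP[monh _ irrh] /irr_seqP[monh' _ irrh'].
  exact: irredp_monic_coprimep.
- by move=> g _; rewrite /nb_irr_factors big_map big_enum.
Qed.

End FinField.

(** * Combining all degrees and evaluating *)

Theorem corollary11 (F : finFieldType) (T : {fset nat}) (m : nat)
    (l : T -> nat) (T_pos : 0%N \notin T) :
  let q : rat := #|F|%:R in
  let I (i : T) : nat := #|irr_polys F (val i)| in
  (Nstar F m l)%:R =
  q ^+ m *
  \sum_(j : {dffun forall i : T, 'I_(I i).+1})
    (\sum_(i : T) val i * (l i + j i) <= m)%N%:R *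
    \prod_(i : T)
      ('C(I i + l i - 1, l i)%:R * q ^- (val i * l i) *
       'C(I i, j i)%:R * (-1) ^+ j i * q ^- (val i * j i)).
Proof.
move=> q I.
have q0 : q != 0.
  by rewrite /q Num.Theory.pnatr_eq0 -lt0n; apply/card_gt0P; exists 0.
have T_gt0 (i : T) : (0 < val i)%N.
  by rewrite lt0n; apply: contraNneq T_pos => <-; apply: fsvalP.
pose P (i : T) : {poly rat} :=
  'C(I i + l i - 1, l i)%:R *: ('X^(val i * l i) * (1 - 'X^(val i)) ^+ I i).
have transform_T (r : seq T) : uniq r ->
    dvd_transform (flatten [seq irr_seq F (val i) | i <- r])
      (fun g => \prod_(i <- r) (nb_irr_factors (val i) g == l i)%:R)
      (\prod_(i <- r) P i).
  elim: r => [_|i r IHr /andP[r'i /IHr{}IHr]].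
    rewrite big_nil -polyC1.
    apply: DvdTransform_eq (dvd_transform_const _ 1) _ => g _.
    by rewrite big_nil.
  have co_i : {in irr_seq F (val i) & flatten [seq irr_seq F (val k) | k <- r],
      forall h1 h2, coprimep h1 h2}.
    move=> h1 h2 /irr_seqP[mon1 s1 irr1] /flatten_mapP[k rk].
    move=> /irr_seqP[mon2 s2 irr2]; apply: irredp_monic_coprimep => //.
    (* A common irreducible would force the degrees [i] and [k] to agree. *)
    apply: contraNneq r'i => h12; suff -> : i = k by [].
    by apply: val_inj; apply: succn_inj; rewrite -s1 -s2 h12.
  have Ti := dvd_transform_nb_irr_factors F (l i) (T_gt0 i).
  rewrite big_cons.
  apply: DvdTransform_eq (dvd_transformM co_i Ti IHr) _ => g _.
  by rewrite big_cons.
have -> : (Nstar F m l)%:R = degree_mass q m (\prod_i P i).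
  rewrite -(sum_dvd_transform m (transform_T _ (index_enum_uniq _))).
  rewrite /Nstar -sum1_card natr_sum big_mkcond [RHS]big_mkcond.
  apply: eq_bigr => g _; rewrite [in LHS]inE.
  (* The product of the indicators is the indicator of the conjunction. *)
  case: (g \in _) => //=; case: forallP => [nbE|nbN].
    by rewrite big1 // => i _; rewrite nbE.
  case: (pickP (fun i => nb_irr_factors (val i) (val g) != l i)) => [i nbi|nbE].
    by rewrite (bigD1 i) //= (negPf nbi) mul0r.
  by case: nbN => i; have /negbFE := nbE i.
pose term (i : T) (j : 'I_(I i).+1) : rat :=
  'C(I i + l i - 1, l i)%:R * 'C(I i, j)%:R * (-1) ^+ j.
(* The indices [j] come from the binomial expansion of [(1 - 'X^i) ^+ I i]. *)
have P_E i : P i = \sum_(j < (I i).+1) term i j *: 'X^(val i * (l i + j)).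
  rewrite /P exprBn big_distrr scaler_sumr; apply: eq_bigr => j _ /=.
  have -> : (-1) ^+ j = ((-1) ^+ j)%:P :> {poly rat}.
    by rewrite polyC_exp polyCN polyC1.
  rewrite expr1n mulr1 -exprM mulnDr exprD /term mul_polyC -!scalerA.
  by rewrite -scaler_nat -!scalerAr.
under eq_bigr => i _ do rewrite P_E.
rewrite prod_sum_dffun degree_mass_sum big_distrr; apply: eq_bigr => j _ /=.
rewrite scaler_prod -expr_sum degree_massZ degree_massXn.
case: leqP => [le_m|_]; last by rewrite !(mul0r, mulr0).
(* Splitting [q ^+ m] leaves the power of the total degree, which cancels the negative powers factor
   by factor. *)
rewrite !mul1r -[m in RHS](subnK le_m) exprD mulrC -mulrA; congr (_ * _).
rewrite expr_sum -big_split; apply: eq_bigr => i _ /=.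
have qn0 n : q ^+ n != 0 by rewrite expf_neq0.
rewrite mulnDr exprD (mulrAC _ (q ^- _)) (mulrAC _ (q ^- _)) -[_ / _ / _]mulrA.
by rewrite -invfM mulrC divfK // mulf_neq0.
Qed.
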